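(* There exist MDPs with priors (that is, a family of MDPs $\{\mathcal{M}(\phi)\}_{\phi\in\Phi}$ together with a prior $P_\Phi$ on $\Phi$) such that $$\Pi^\star_{\mathrm{QBRL}}\cap\Pi^\star_{\mathrm{Bayes}}=\varnothing.$$
   Context: Setting. A family of infinite-horizon discounted MDPs $\mathcal{M}(\phi)$, $\phi\in\Phi$, shares a state space $\mathcal{S}$, action set $\mathcal{A}$, initial state distribution $P_0$ and discount factor $\gamma$; $P_{R,S}(s,a,\phi)$ is the joint reward-next-state distribution of $\mathcal{M}(\phi)$, and $P_\Phi$ is a prior on $\Phi$. A history is $h_t=\{s_0,a_0,r_0,s_1,\ldots,a_{t-1},r_{t-1},s_t\}$; $\mathcal{H}$ is the space of all histories; $\mathcal{P}(\mathcal{A})$ denotes probability distributions on $\mathcal{A}$. Bayes-optimal policies. $P_\Phi(h_t)$ is the posterior over $\phi$ given $h_t$ and $P_{R,S}(h_t,a_t):=\mathbb{E}_{\phi\sim P_\Phi(h_t)}[P_{R,S}(s_t,a_t,\phi)]$. With $\Pi_{\mathcal{H}}:=\{\pi:\mathcal{H}\to\mathcal{P}(\mathcal{A})\}$ and, for $\pi\in\Pi_{\mathcal{H}}$, $J^\pi_{\mathrm{Bayes}}:=\mathbb{E}[\sum_{i=0}^\infty\gamma^ir_i]$ where $s_0\sim P_0$, $a_i\sim\pi(h_i)$, $(r_i,s_{i+1})\sim P_{R,S}(h_i,a_i)$, the set of Bayes-optimal policies is $\Pi^\star_{\mathrm{Bayes}}:=\arg\max_{\pi\in\Pi_{\mathcal{H}}}J^\pi_{\mathrm{Bayes}}$.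 QBRL-optimal policies. Let $Q^\star(s,a,\phi)$ be the optimal $Q$-function of $\mathcal{M}(\phi)$, satisfying $Q^\star(s,a,\phi)=\mathbb{E}_{r,s'\sim P_{R,S}(s,a,\phi)}[r+\gamma\max_{a'}Q^\star(s',a',\phi)]$, and $Q^\star_{\mathrm{QBRL}}(h_t,a_t)=\mathbb{E}_{\phi\sim P_\Phi(h_t)}[Q^\star(s_t,a_t,\phi)]$. An optimal QBRL policy is constructed by taking $a^\star\in\arg\max_{a'}Q^\star_{\mathrm{QBRL}}(h_t,a')$, and $\Pi^\star_{\mathrm{QBRL}}$ denotes the set of all optimal QBRL policies. In the paper this set is also characterised as $\arg\max_{\pi\in\Pi_{\mathrm{QBRL}}}J^\pi_{\mathrm{Bayes}}=\{\mathbb{E}_{\phi\sim P_\Phi(h_t)}[\pi^\star(\cdot,\phi)]\mid\pi^\star\in\Pi^\star_\Phi\}$, where $\Pi_\Phi:=\{\pi:\mathcal{S}\times\Phi\to\mathcal{P}(\mathcal{A})\}$ is the set of context-conditioned policies, $\Pi_{\mathrm{QBRL}}:=\{\mathbb{E}_{\phi\sim P_\Phi(h_t)}[\pi(\cdot,\phi)]\mid\pi\in\Pi_\Phi\}$, and $\Pi^\star_\Phi$ is the set of $\pi^\star\in\Pi_\Phi$ such that $\pi^\star(\cdot,\phi)$ is optimal (maximises expected discounted return) in $\mathcal{M}(\phi)$ for every $\phi$. *)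

(* Defs.v *)
From HB Require Import structures.
From mathcomp Require Import all_boot all_order all_algebra.
From mathcomp Require Import all_classical all_reals all_analysis.
Set Implicit Arguments.
Unset Strict Implicit.
Unset Printing Implicit Defensive.
Import Order.TTheory GRing.Theory Num.Theory.
Import numFieldNormedType.Exports.
Local Open Scope classical_set_scope.
Local Open Scope ring_scope.

Record dist (R : realType) (T : finType) := Dist {
  dist_fun :> T -> R;
  dist_ge0 : forall x, 0 <= dist_fun x;
  dist_sum1 : \sum_x dist_fun x = 1 }.

(* All spaces are finite, so that every argmax set below is nonempty and
   disjointness is never vacuous for lack of optimal policies.  The type
   [reward] indexes the finite set of real numbers occurring as rewards; by
   injectivity of [rval], observing an index is observing a real reward. *)
Record mdp_family (R : realType) := MDPFamily {
  state : finType;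
  action : finType;
  action_nonempty : (0 < #|action|)%N;
  context : finType;
  reward : finType;
  rval : reward -> R;
  rval_inj : injective rval;
  gamma : R;
  gamma_ge0 : 0 <= gamma;
  gamma_lt1 : gamma < 1;
  P0 : dist R state;
  PRS : state -> action -> context -> dist R (reward * state)%type;
  prior : dist R context }.

Section Theory.
Context {R : realType} (M : mdp_family R).
Local Notation S := (state M).
Local Notation A := (action M).
Local Notation Phi := (context M).
Local Notation Rw := (reward M).

Definition step : Type := (A * Rw * S)%type.

(* {s_0, a_0, r_0, s_1, ..., a_(t-1), r_(t-1), s_t} is encoded as
   (s_0, [:: (a_0, r_0, s_1); ...; (a_(t-1), r_(t-1), s_t)]). *)
Definition hist : Type := (S * seq step)%type.

Definition cur_state (h : hist) : S := last h.1 [seq x.2 | x <- h.2].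

Definition hpolicy : Type := hist -> dist R A.

Definition cpolicy : Type := S -> Phi -> dist R A.

Fixpoint steps_likelihood (s : S) (w : seq step) (phi : Phi) : R :=
  if w is (a, r, s') :: w' then
    PRS s a phi (r, s') * steps_likelihood s' w' phi
  else 1.

Definition likelihood (h : hist) (phi : Phi) : R :=
  steps_likelihood h.1 h.2 phi.

Definition evidence (h : hist) : R :=
  \sum_phi prior M phi * likelihood h phi.

(* Bayes' rule; neither [P0] nor the action probabilities depend on the
   context, so they cancel.  Meaningful only when [evidence h] is positive:
   the (null) histories without evidence have no posterior. *)
Definition posterior (h : hist) (phi : Phi) : R :=
  prior M phi * likelihood h phi / evidence h.

Definition predictive (h : hist) (a : A) (rs : Rw * S) : R :=
  \sum_phi posterior h phi * PRS (cur_state h) a phi rs.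

(* [steps_prob K pi h w] is the probability that the history [h] is continued
   by the steps [w] when a_i ~ pi(h_i) and (r_i, s_(i+1)) ~ K(h_i, a_i). *)
Fixpoint steps_prob (K : hist -> A -> Rw * S -> R) (pi : hpolicy)
    (h : hist) (w : seq step) : R :=
  if w is (a, r, s') :: w' then
    pi h a * K h a (r, s') *
      steps_prob K pi (h.1, rcons h.2 (a, r, s')) w'
  else 1.

Definition discounted_return n (w : n.-tuple step) : R :=
  \sum_(i < n) gamma M ^+ i * rval (tnth w i).1.2.

(* The expectation of the return of the first [n] steps. *)
Definition truncated_return (K : hist -> A -> Rw * S -> R) (pi : hpolicy)
    (n : nat) : R :=
  \sum_s \sum_(w : n.-tuple step)
    P0 M s * steps_prob K pi (s, [::]) w * discounted_return w.

(* E[\sum_i gamma^i r_i], as the limit of the expected truncated returns: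
   the rewards are bounded and gamma < 1, so limit and expectation commute. *)
Definition expected_return (K : hist -> A -> Rw * S -> R) (pi : hpolicy) : R :=
  limn (truncated_return K pi).

Definition J_Bayes (pi : hpolicy) : R := expected_return predictive pi.

Definition Bayes_optimal : set hpolicy :=
  [set pi | forall pi' : hpolicy, J_Bayes pi' <= J_Bayes pi].

Definition J_MDP (phi : Phi) (pi : S -> dist R A) : R :=
  expected_return (fun h a rs => PRS (cur_state h) a phi rs)
                  (fun h => pi (cur_state h)).

Definition context_optimal : set cpolicy :=
  [set pi | forall phi (pi' : S -> dist R A),
              J_MDP phi pi' <= J_MDP phi (fun s => pi s phi)].

(* The Bellman optimality equation; it has exactly one solution, Q^*. *)
Definition is_Qstar (Q : S -> A -> Phi -> R) : Prop :=
  forall s a phi, Q s a phi =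
    \sum_rs PRS s a phi rs *
      (rval rs.1 + gamma M * sup (range (fun a' => Q rs.2 a' phi))).

Definition Q_QBRL (Q : S -> A -> Phi -> R) (h : hist) (a : A) : R :=
  \sum_phi posterior h phi * Q (cur_state h) a phi.

(* Policies picking actions in argmax_a' Q^*_QBRL(h, a') (ties may be broken at
   random).  Histories without evidence are unconstrained here and below: they
   have probability zero under the Bayesian model, so this only enlarges the
   sets of QBRL policies, and J_Bayes does not depend on them. *)
Definition QBRL_greedy : set hpolicy :=
  [set pi | exists2 Q, is_Qstar Q &
     forall h, 0 < evidence h -> forall a, 0 < pi h a ->
       forall a', Q_QBRL Q h a' <= Q_QBRL Q h a].

Definition posterior_mixture (pic : cpolicy) (pi : hpolicy) : Prop :=
  forall h, 0 < evidence h -> forall a,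
    pi h a = \sum_phi posterior h phi * pic (cur_state h) phi a.

Definition QBRL_policies : set hpolicy :=
  [set pi | exists pic : cpolicy, posterior_mixture pic pi].

Definition QBRL_mixture : set hpolicy :=
  [set pi | exists2 pic, context_optimal pic & posterior_mixture pic pi].

Definition QBRL_argmax : set hpolicy :=
  [set pi | QBRL_policies pi /\
     forall pi', QBRL_policies pi' -> J_Bayes pi' <= J_Bayes pi].

End Theory.

Arguments Bayes_optimal {R} M.
Arguments QBRL_greedy {R} M.
Arguments QBRL_mixture {R} M.
Arguments QBRL_argmax {R} M.

(* Main.v *)
(* In the family below a single action is informative: in its only state the
   risky arm pays 3 in one context and -4 in the other, the safe arm pays 0, the
   contexts are equally likely and the discount is 1/2. A Bayes-optimal policy
   must pay the expected price 1/2 of one risky pull to learn the context, and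
   must then stop pulling after a loss. Averaging Q^* assumes that the context
   is revealed anyway, so the greedy policy never pulls. A posterior mixture
   that surely pulls at the start pulls surely in both contexts, hence pulls
   again after a loss. *)
Require Import Defs.
From mathcomp Require Import all_boot all_order all_algebra.
From mathcomp Require Import all_classical all_reals all_analysis.
From mathcomp Require Import ring lra.
Set Implicit Arguments.
Unset Strict Implicit.
Unset Printing Implicit Defensive.
Import Order.TTheory GRing.Theory Num.Theory.
Import numFieldNormedType.Exports.
Local Open Scope classical_set_scope.
Local Open Scope ring_scope.

(** * Policy evaluation on histories and bounds on the Bayesian return *)

Section BayesReturn.
Context {R : realType} (M : mdp_family R).
Implicit Types (U : hist M -> R) (h : hist M) (x : step M) (pi : hpolicy M).

Definition append h x : hist M := (h.1, rcons h.2 x).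

Definition next_mean pi h (G : step M -> R) : R :=
  \sum_a pi h a * \sum_rs predictive h a rs * G (a, rs.1, rs.2).

(** The evaluation operator of [pi] in the Bayes-adaptive MDP, whose states are the histories. *)
Definition bellman pi (U : hist M -> R) h : R :=
  next_mean pi h (fun x => rval x.1.2 + gamma M * U (append h x)).

(** Starting from an arbitrary history lets induction on [n] move the first step into [h]. *)
Definition n_step_return pi n h : R :=
  \sum_(w : n.-tuple (step M))
    steps_prob (@predictive R M) pi h w * discounted_return w.

Lemma sum_tupleS (T : finType) n (F : n.+1.-tuple T -> R) :
  \sum_w F w = \sum_x \sum_(w : n.-tuple T) F [tuple of x :: w].
Proof.
rewrite pair_big /= (reindex (fun p : T * n.-tuple T => [tuple of p.1 :: p.2])) //.
exists (fun w => (thead w, [tuple of behead w])) => [[x w] _ | w _] /=.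
  by congr pair; apply: val_inj.
by rewrite [RHS]tuple_eta.
Qed.

Lemma steps_likelihood_ge0 s w (phi : context M) :
  0 <= steps_likelihood s w phi.
Proof.
by elim: w s => [|[[a r] s'] w IHw] s //=; rewrite mulr_ge0 ?dist_ge0.
Qed.

Lemma steps_likelihood_rcons s w a r s' (phi : context M) :
  steps_likelihood s (rcons w (a, r, s')) phi =
  steps_likelihood s w phi * PRS (last s [seq x.2 | x <- w]) a phi (r, s').
Proof.
elim: w s => [|[[b q] t] w IHw] s /=; first by rewrite mulr1 mul1r.
by rewrite IHw mulrA.
Qed.

Lemma posterior_ge0 h phi : 0 <= posterior h phi.
Proof.
rewrite divr_ge0 ?sumr_ge0 ?mulr_ge0 ?dist_ge0 ?steps_likelihood_ge0 // => psi _.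
by rewrite mulr_ge0 ?dist_ge0 ?steps_likelihood_ge0.
Qed.

Lemma sum_posterior h : 0 < evidence h -> \sum_phi posterior h phi = 1.
Proof. by move=> ev; rewrite -mulr_suml divff // gt_eqF. Qed.

(** With this ratio, a step of positive predictive probability leads from a history with evidence to
    another one. *)
Lemma predictive_evidence h a r s :
  predictive h a (r, s) = evidence (append h (a, r, s)) / evidence h.
Proof.
rewrite /predictive /evidence mulr_suml; apply: eq_bigr => phi _.
by rewrite /posterior /likelihood /= steps_likelihood_rcons -/(cur_state h); ring.
Qed.

Lemma predictive_ge0 h a rs : 0 <= predictive h a rs.
Proof. by apply: sumr_ge0 => phi _; rewrite mulr_ge0 ?posterior_ge0 ?dist_ge0. Qed.

Lemma sum_predictive h a (F : reward M * state M -> R) :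
  \sum_rs predictive h a rs * F rs =
  \sum_phi posterior h phi * \sum_rs PRS (cur_state h) a phi rs * F rs.
Proof.
under eq_bigr do rewrite mulr_suml.
rewrite exchange_big; apply: eq_bigr => phi _ /=.
by rewrite mulr_sumr; apply: eq_bigr => rs _; rewrite mulrA.
Qed.

Lemma next_mean_posterior pi h G : next_mean pi h G =
  \sum_a pi h a * \sum_phi posterior h phi *
    \sum_rs PRS (cur_state h) a phi rs * G (a, rs.1, rs.2).
Proof. by apply: eq_bigr => a _; rewrite sum_predictive. Qed.

Lemma next_mean_le pi h G1 G2 : 0 < evidence h ->
  (forall x, 0 < evidence (append h x) -> G1 x <= G2 x) ->
  next_mean pi h G1 <= next_mean pi h G2.
Proof.
move=> ev leG; apply: ler_sum => a _; apply: ler_wpM2l; first exact: dist_ge0.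
apply: ler_sum => -[r s] _ /=.
have /orP[/eqP <-|Kgt0] : (0 == predictive h a (r, s)) || (0 < predictive h a (r, s)).
- by rewrite -le_eqVlt predictive_ge0.
- by rewrite !mul0r.
rewrite ler_wpM2l ?predictive_ge0 // leG //.
by rewrite predictive_evidence pmulr_lgt0 ?invr_gt0 // in Kgt0.
Qed.

Lemma next_mean_eq pi h G1 G2 : 0 < evidence h ->
  (forall x, 0 < evidence (append h x) -> G1 x = G2 x) ->
  next_mean pi h G1 = next_mean pi h G2.
Proof.
by move=> ev eqG; apply/le_anti; rewrite !next_mean_le // => x evx; rewrite eqG.
Qed.

Lemma next_meanD pi h G1 G2 :
  next_mean pi h (fun x => G1 x + G2 x) = next_mean pi h G1 + next_mean pi h G2.
Proof.
rewrite -big_split; apply: eq_bigr => a _ /=.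
rewrite -mulrDr -big_split; congr (_ * _); apply: eq_bigr => rs _ /=.
by rewrite mulrDr.
Qed.

Lemma next_mean_cst pi h c : 0 < evidence h -> next_mean pi h (fun=> c) = c.
Proof.
move=> ev; rewrite next_mean_posterior.
under eq_bigr do under eq_bigr do rewrite -mulr_suml dist_sum1 mul1r.
under eq_bigr do rewrite -mulr_suml sum_posterior // mul1r.
by rewrite -mulr_suml dist_sum1 mul1r.
Qed.

(** Conditioning on the first step. A general [F] serves both the total mass and the return. *)
Lemma sum_steps_probS pi n h (F : n.+1.-tuple (step M) -> R) :
  \sum_(w : n.+1.-tuple (step M)) steps_prob (@predictive R M) pi h w * F w =
  next_mean pi h (fun x =>
    \sum_(w : n.-tuple (step M))
      steps_prob (@predictive R M) pi (append h x) w * F [tuple of x :: w]).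
Proof.
rewrite sum_tupleS /next_mean.
under [RHS]eq_bigr do rewrite mulr_sumr.
rewrite [RHS]pair_big /=.
rewrite (reindex (fun p : action M * (reward M * state M) => (p.1, p.2.1, p.2.2))) /=.
  apply: eq_bigr => -[a [r s]] _ /=.
  by rewrite mulrA [RHS]mulr_sumr; apply: eq_bigr => w _ /=; rewrite !mulrA.
by exists (fun x => (x.1.1, (x.1.2, x.2))) => [[a [r s]]|[[a r] s]].
Qed.

Lemma sum_steps_prob pi n h : 0 < evidence h ->
  \sum_(w : n.-tuple (step M)) steps_prob (@predictive R M) pi h w = 1.
Proof.
elim: n h => [|n IHn] h ev.
  rewrite (big_pred1 [tuple]) // => w; apply/esym/eqP; exact: tuple0.
rewrite -(eq_bigr _ (fun w _ => mulr1 _)) (sum_steps_probS _ _ (fun=> 1)).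
rewrite (@next_mean_eq _ _ _ (fun=> 1)) ?next_mean_cst //.
by move=> x evx; under eq_bigr do rewrite mulr1; apply: IHn.
Qed.

Lemma n_step_return0 pi h : n_step_return pi 0 h = 0.
Proof. by apply: big1 => w _; rewrite /discounted_return big_ord0 mulr0. Qed.

Lemma n_step_returnS pi n h : 0 < evidence h ->
  n_step_return pi n.+1 h = bellman pi (n_step_return pi n) h.
Proof.
move=> ev; rewrite /n_step_return sum_steps_probS; apply: next_mean_eq => // x evx.
(* The first reward is spread over all continuations [w], whose total probability is 1. *)
rewrite -[X in X + _]mul1r -(sum_steps_prob pi n evx) mulr_suml mulr_sumr -big_split.
apply: eq_bigr => w _ /=.
rewrite mulrCA -mulrDr; congr (_ * _).
rewrite /discounted_return big_ord_recl expr0 mul1r tnth0; congr (_ + _).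
by rewrite mulr_sumr; apply: eq_bigr => i _; rewrite exprS -mulrA tnthS.
Qed.

Lemma bellman_shift pi U c h : 0 < evidence h ->
  bellman pi (fun g => U g + c) h = bellman pi U h + gamma M * c.
Proof.
move=> ev; rewrite -[X in _ + X](next_mean_cst pi _ ev) -next_meanD.
by apply: next_mean_eq => // x _; rewrite mulrDr addrA.
Qed.

Lemma bellman_le pi U1 U2 h : 0 < evidence h ->
  (forall x, 0 < evidence (append h x) -> U1 (append h x) <= U2 (append h x)) ->
  bellman pi U1 h <= bellman pi U2 h.
Proof.
move=> ev leU; apply: next_mean_le => // x evx.
by rewrite lerD2l ler_wpM2l ?gamma_ge0 ?leU.
Qed.

(** Induction on [n]: [bellman] is monotone and multiplies an added constant by [gamma M], so the
    initial error [C] decays geometrically. *)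
Lemma n_step_return_le pi U C : (forall h, - C <= U h) ->
  (forall h, 0 < evidence h -> bellman pi U h <= U h) ->
  forall n h, 0 < evidence h -> n_step_return pi n h <= U h + C * gamma M ^+ n.
Proof.
move=> geU superU; elim=> [|n IHn] h ev.
  by rewrite n_step_return0 expr0 mulr1 -lerBlDr sub0r.
rewrite n_step_returnS // exprS mulrCA.
apply: le_trans (lerD (superU h ev) (lexx _)).
by rewrite -bellman_shift //; apply: bellman_le => // x; apply: IHn.
Qed.

Lemma n_step_return_ge pi U C : (forall h, U h <= C) ->
  (forall h, 0 < evidence h -> U h <= bellman pi U h) ->
  forall n h, 0 < evidence h -> U h - C * gamma M ^+ n <= n_step_return pi n h.
Proof.
move=> leU subU; elim=> [|n IHn] h ev.
  by rewrite n_step_return0 expr0 mulr1 subr_le0.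
rewrite n_step_returnS // exprS mulrCA -mulrN.
apply: le_trans (lerD (subU h ev) (lexx _)) _.
by rewrite -bellman_shift //; apply: bellman_le => // x; apply: IHn.
Qed.

Lemma truncated_returnE pi n : truncated_return (@predictive R M) pi n =
  \sum_s P0 M s * n_step_return pi n (s, [::]).
Proof.
apply: eq_bigr => s _; rewrite mulr_sumr; apply: eq_bigr => w _.
by rewrite mulrA.
Qed.

Lemma evidence_nil s : evidence ((s, [::]) : hist M) = 1.
Proof.
by rewrite /evidence /likelihood /=; under eq_bigr do rewrite mulr1; apply: dist_sum1.
Qed.

Lemma cvg_discount (C : R) : C * gamma M ^+ n @[n --> \oo] --> 0.
Proof.
rewrite -(mulr0 C); apply: cvgMr; apply: cvg_expr.
by rewrite ger0_norm ?gamma_ge0 ?gamma_lt1.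
Qed.

(* Convergence of the truncated returns is not needed: [limn] is [0] if it
   fails, whence the hypothesis that the bound is nonnegative. *)
Lemma J_Bayes_le pi U C : (forall h, - C <= U h) ->
  (forall h, 0 < evidence h -> bellman pi U h <= U h) ->
  0 <= \sum_s P0 M s * U (s, [::]) ->
  J_Bayes pi <= \sum_s P0 M s * U (s, [::]).
Proof.
move=> geU superU U0; rewrite /J_Bayes /expected_return.
have [cv|/dvgP-> //] := pselect (cvgn (truncated_return (@predictive R M) pi)).
set B := \sum_s _.
have cvB : B + C * gamma M ^+ n @[n --> \oo] --> B.
  by rewrite -[X in _ --> X]addr0; apply: cvgD; [exact: cvg_cst|exact: cvg_discount].
rewrite -(cvg_lim _ cvB) //; apply: ler_lim => //; first by apply: cvgP cvB.
apply: nearW => n; rewrite truncated_returnE.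
rewrite -[X in _ + X]mul1r -(dist_sum1 (P0 M)) mulr_suml -big_split.
apply: ler_sum => s _ /=; rewrite -mulrDr ler_wpM2l ?dist_ge0 //.
by rewrite n_step_return_le // evidence_nil.
Qed.

(** A bounded fixed point of [bellman] is both a super- and a subsolution, which squeezes the
    truncated returns. *)
Lemma J_Bayes_eq pi U C : (forall h, `|U h| <= C) ->
  (forall h, 0 < evidence h -> bellman pi U h = U h) ->
  J_Bayes pi = \sum_s P0 M s * U (s, [::]).
Proof.
move=> normU harmU; rewrite /J_Bayes /expected_return; apply: cvg_lim => //.
have le_normU h : - C <= U h <= C by rewrite -ler_norml.
set B := \sum_s _.
apply: (squeeze_cvgr (f := fun n => B - C * gamma M ^+ n)
                     (h := fun n => B + C * gamma M ^+ n)).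
- apply: nearW => n; rewrite truncated_returnE -mulNr.
  rewrite -[X in B + X <= _]mul1r -[X in _ <= B + X]mul1r -(dist_sum1 (P0 M)).
  rewrite !mulr_suml -!big_split.
  apply/andP; split; apply: ler_sum => s _ /=.
  + rewrite -mulrDr ler_wpM2l ?dist_ge0 // mulNr n_step_return_ge ?evidence_nil //.
      by move=> h; case/andP: (le_normU h).
    by move=> h /harmU ->.
  + rewrite -mulrDr ler_wpM2l ?dist_ge0 // n_step_return_le ?evidence_nil //.
      by move=> h; case/andP: (le_normU h).
    by move=> h /harmU ->.
- rewrite -[X in _ --> X]subr0; apply: cvgB; [exact: cvg_cst|exact: cvg_discount].
- rewrite -[X in _ --> X]addr0; apply: cvgD; [exact: cvg_cst|exact: cvg_discount].
Qed.

End BayesReturn.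

(** * The two-armed family and its Bayes-optimal policies *)

Section RiskyArm.
Variable R : realType.

Lemma point_mass_subproof (T : finType) (x0 : T) :
  (forall x, 0 <= (x == x0)%:R :> R) /\ \sum_x (x == x0)%:R = 1 :> R.
Proof.
split=> [x|]; first by rewrite ler0n.
rewrite (bigD1 x0) //= eqxx big1 ?addr0 // => x /negbTE ->; exact: erefl.
Qed.

Definition point_mass (T : finType) (x0 : T) : dist R T :=
  Dist (proj1 (point_mass_subproof x0)) (proj2 (point_mass_subproof x0)).

Lemma fair_coin_subproof :
  (forall b : bool, 0 <= 2^-1 :> R) /\ \sum_(b : bool) 2^-1 = 1 :> R.
Proof. by split=> [b|]; rewrite ?big_bool /=; lra. Qed.

Definition fair_coin : dist R bool :=
  Dist (proj1 fair_coin_subproof) (proj2 fair_coin_subproof).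

Definition payoff (r : option bool) : R :=
  if r is Some b then if b then 3 else -4 else 0.

Lemma payoff_inj : injective payoff.
Proof. by case=> [[]|] [[]|] //= eq_payoff; exfalso; lra. Qed.

Definition outcome (a phi : bool) : option bool := if a then Some phi else None.

Lemma half_lt1 : 2^-1 < 1 :> R. Proof. by lra. Qed.
Lemma half_ge0 : 0 <= 2^-1 :> R. Proof. by lra. Qed.
Lemma card_bool_gt0 : (0 < #|{: bool}|)%N. Proof. by rewrite card_bool. Qed.

(* Action [true] is the risky arm, action [false] pays nothing and reveals
   nothing; the context says whether the risky arm wins. *)
Definition risky_arm : mdp_family R :=
  MDPFamily card_bool_gt0 payoff_inj half_ge0 half_lt1 (point_mass tt)
    (fun (_ : unit) (a phi : bool) => point_mass (outcome a phi, tt)) fair_coin.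

Implicit Types (h : hist risky_arm) (pi : hpolicy risky_arm).

Definition start : hist risky_arm := (tt, [::]).
Definition win : step risky_arm := (true, Some true, tt).
Definition loss : step risky_arm := (true, Some false, tt).
Definition pass : step risky_arm := (false, None, tt).

(** Outcomes are determined by action and context, so every likelihood is 0 or 1 and a belief
    amounts to the set of contexts not yet refuted. *)
Definition consistent h (phi : bool) : bool :=
  all (fun x : step risky_arm => x.1.2 == outcome x.1.1 phi) h.2.

Lemma consistent_append h a r s phi :
  consistent (append h (a, r, s)) phi = consistent h phi && (r == outcome a phi).
Proof. by rewrite /consistent /= all_rcons andbC. Qed.

Lemma likelihoodE h phi : likelihood h phi = (consistent h phi)%:R.
Proof.
case: h => s w; rewrite /likelihood /consistent /=.
elim: w s => [|[[a r] s'] w IHw] s //=; rewrite IHw -mulnb natrM; congr (_ * _).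
by congr (_%:R); rewrite xpair_eqE; case: s'; rewrite andbT.
Qed.

Lemma evidenceE h :
  evidence h = ((consistent h true)%:R + (consistent h false)%:R) / 2.
Proof. by rewrite /evidence big_bool /= !likelihoodE; lra. Qed.

Lemma evidence_gt0 h :
  (0 < evidence h) = consistent h true || consistent h false.
Proof. by rewrite evidenceE; do 2!case: (consistent h _) => /=; lra. Qed.

Lemma posteriorE h phi : posterior h phi =
  if consistent h phi then if consistent h (~~ phi) then 2^-1 else 1 else 0.
Proof.
rewrite /posterior evidenceE likelihoodE /=.
by case: phi; do 2!case: (consistent h _) => /=; rewrite ?(mulr0, mul0r) //; field.
Qed.

Lemma dist_false (P : dist R bool) : P false = 1 - P true.
Proof. by have := dist_sum1 P; rewrite big_bool /=; lra. Qed.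

Lemma dist_true_le1 (P : dist R bool) : P true <= 1.
Proof. by have := dist_ge0 P false; rewrite dist_false; lra. Qed.

Lemma sum_point_mass (T : finType) (x0 : T) (F : T -> R) :
  \sum_x point_mass x0 x * F x = F x0.
Proof.
rewrite (bigD1 x0) //= eqxx mul1r big1 ?addr0 // => x /negbTE ->.
by rewrite mul0r.
Qed.

Lemma bellmanE pi (U : hist risky_arm -> R) h : bellman pi U h =
  pi h true * (posterior h true * (3 + U (append h win) / 2) +
               posterior h false * (-4 + U (append h loss) / 2)) +
  (1 - pi h true) * ((posterior h true + posterior h false) *
                     (U (append h pass) / 2)).
Proof.
rewrite /bellman next_mean_posterior big_bool /= big_bool /= big_bool /=.
rewrite !sum_point_mass /= dist_false; ring.
Qed.

(* The optimal value of a history, given whether it is consistent with the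
   winning and with the losing context. *)
Definition value (good bad : bool) : R := if good then if bad then 1 else 6 else 0.

Definition optimal_policy : hpolicy risky_arm :=
  fun h => point_mass (consistent h true).

Lemma J_optimal : J_Bayes optimal_policy = 1.
Proof.
rewrite (@J_Bayes_eq _ risky_arm _
  (fun h => value (consistent h true) (consistent h false)) 6).
- by rewrite (sum_point_mass tt).
- by move=> h; rewrite /value; do 2?case: ifP => _; rewrite ler_norml; lra.
move=> h; rewrite evidence_gt0 bellmanE !consistent_append !posteriorE /=.
by rewrite /value; case: (consistent h _); case: (consistent h _) => //= _; lra.
Qed.

(** A first pull is worth at most [(3 + 6/2)/2 + (-4 - 4 * q / 2)/2 = 1 - q], a first pass at most
    [1/2]; weighting by [p] and [1 - p] gives the bound. *)
Lemma J_risky_le pi (p := pi start true) (q := pi (append start loss) true) :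
  J_Bayes pi <= (1 + p) / 2 - p * q.
Proof.
have [p0 p1] : 0 <= p /\ p <= 1 by split; [exact: dist_ge0|exact: dist_true_le1].
have [q0 q1] : 0 <= q /\ q <= 1 by split; [exact: dist_ge0|exact: dist_true_le1].
(* This makes the bound nonnegative, as [J_Bayes_le] requires. *)
have pq1 : p * q <= p by rewrite ler_piMr.
(* [U] is the optimal value except at the start and after a first loss, where
   only the next action of [pi] is followed. *)
pose U h := if h.2 == [::] then (1 + p) / 2 - p * q
  else if h.2 == [:: loss] then -4 * q
  else value (consistent h true) (consistent h false).
have startU : \sum_s P0 risky_arm s * U (s, [::]) = (1 + p) / 2 - p * q.
  by rewrite (sum_point_mass tt).
rewrite -startU; apply: (@J_Bayes_le _ _ _ _ 4) => [h|h|]; last by rewrite startU; lra.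
  rewrite /U /value; do 4?case: ifP => _; lra.
move=> ev; rewrite bellmanE !posteriorE; move: ev; rewrite evidence_gt0 /U.
have rcons_nil x : (rcons h.2 x == [::]) = false by case: h.2.
rewrite /= !rcons_nil !consistent_append /= {U startU rcons_nil}.
have [r0 r1] : 0 <= pi h true /\ pi h true <= 1.
  by split; [exact: dist_ge0|exact: dist_true_le1].
case: h r0 r1 => -[] [|x w] r0 r1.
  by move=> _ /=; rewrite -/start -/p; lra.
(* Extending a nonempty history gives at least two steps, so there [U] is [value]. *)
have rcons_loss y : (rcons (tt, x :: w).2 y == [:: loss]) = false.
  by apply/eqP => /(congr1 size); rewrite size_rcons.
rewrite !rcons_loss /=.
have [[-> ->] _ /=|_] := (x :: w) =P [:: loss].
  by rewrite -[pi (tt, [:: loss]) true]/q; lra.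
rewrite /value; case: (consistent _ true); case: (consistent _ false) => //= _; lra.
Qed.

(** The return must reach 1, while [(1 + p) / 2 - p * q] does so only for [p = 1] and [q = 0]. *)
Lemma Bayes_optimal_risky pi : Bayes_optimal risky_arm pi ->
  pi start true = 1 /\ pi (append start loss) true = 0.
Proof.
move=> /(_ optimal_policy); rewrite J_optimal => leJ.
have := le_trans leJ (J_risky_le pi).
set p := pi _ _; set q := pi _ _ => le1.
have pq0 : 0 <= p * q by rewrite mulr_ge0 ?dist_ge0.
have p1 : p <= 1 by exact: dist_true_le1.
have {}p1 : p = 1 by lra.
by split=> //; rewrite p1 mul1r in le1 pq0; lra.
Qed.

Lemma greedy_not_Bayes_optimal :
  QBRL_greedy risky_arm `&` Bayes_optimal risky_arm = set0.
Proof.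
apply/seteqP; split=> // pi [[Q QQ greedy] /Bayes_optimal_risky[p1 _]].
have start_ev : 0 < evidence start by rewrite evidence_gt0.
have := greedy start start_ev true; rewrite p1 ltr01 => /(_ isT false).
(* After one Bellman unfolding both actions carry the same [sup] terms; these cancel, leaving the
   absurd [0 <= (3 - 4) / 2]. *)
rewrite /Q_QBRL !big_bool /= !posteriorE /= !QQ /= !sum_point_mass /=.
lra.
Qed.

(** Stated for all posterior mixtures, so that it covers [QBRL_mixture] and [QBRL_argmax] at
    once. *)
Lemma mixture_not_Bayes_optimal :
  QBRL_policies (M:=risky_arm) `&` Bayes_optimal risky_arm = set0.
Proof.
apply/seteqP; split=> // pi [[pic mix] /Bayes_optimal_risky[p1 q0]].
have := mix start; rewrite evidence_gt0 => /(_ isT true).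
rewrite p1 big_bool /= !posteriorE /=.
have := mix (append start loss); rewrite evidence_gt0 => /(_ isT true).
rewrite q0 big_bool /= !posteriorE /=.
(* A loss leaves only the losing context, whose pull probability is thus 0; the average 1 at the
   start would then need probability 2 in the winning one. *)
have := dist_true_le1 (pic tt true); lra.
Qed.

End RiskyArm.

(* The descriptions of the set of optimal QBRL policies (greedy for the
   posterior mean of Q^*, posterior mixtures of optimal context-conditioned
   policies, maximisers of J_Bayes among QBRL policies) do not coincide in
   general; the claim is made for each of them, on one and the same family. *)
Theorem corollary3p6 (R : realType) :
  exists M : mdp_family R,
    [/\ QBRL_greedy M `&` Bayes_optimal M = set0,
        QBRL_mixture M `&` Bayes_optimal M = set0 &
        QBRL_argmax M `&` Bayes_optimal M = set0].
Proof.
exists (risky_arm R).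
have mixture := mixture_not_Bayes_optimal R.
split; first exact: greedy_not_Bayes_optimal.
  apply/seteqP; split=> // pi [[pic _ mix] opt].
  by rewrite -mixture; split=> //; exists pic.
by apply/seteqP; split=> // pi [[mix _] opt]; rewrite -mixture.
Qed.
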